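(* Let $0<\underline{\tau}<\bar{\tau}$ and let $\theta\in\mathbb{R}\setminus\{0\}$. Then there exist three functions $\psi_{01},\psi_{02},\psi_{03}\in L^2([0,1],d\xi)$, orthonormal with respect to $\langle f,g\rangle=\int_0^1 f g\,d\xi$, such that for all $\beta_0,\beta_1,\beta_2\in\mathbb{R}$ the rescaled Nelson-Siegel term structure $\tilde{\tau}\mapsto \hat{y}\big((\bar{\tau}-\underline{\tau})\tilde{\tau}+\underline{\tau}\mid\Theta\big)$, $\tilde{\tau}\in[0,1]$, with $\Theta=(\beta_0,\beta_1,\beta_2,\theta)$, belongs to $\mathrm{Span}(\psi_{01},\psi_{02},\psi_{03})\subset L^2([0,1],d\xi)$.
   Context: $L^2([0,1],d\xi)$ is the space of real square-integrable functions on $[0,1]$ with inner product $\langle f,g\rangle=\int_0^1 fg\,d\xi$. For parameters $\Theta=(\beta_0,\beta_1,\beta_2,\theta)$ and maturity $\tau\in[\underline{\tau},\bar{\tau}]$, the Nelson-Siegel term structure is $$\hat{y}(\tau\mid\Theta)=\beta_0+\beta_1\frac{1-e^{-\theta\tau}}{\theta\tau}+\beta_2\left(\frac{1-e^{-\theta\tau}}{\theta\tau}-e^{-\theta\tau}\right).$$ The maturity is rescaled to $[0,1]$ by $\tilde{\tau}=\dfrac{\tau-\underline{\tau}}{\bar{\tau}-\underline{\tau}}$, and $\hat{y}$ is viewed as a function of $\tilde{\tau}\in[0,1]$. The basis functions may depend on $\theta,\underline{\tau},\bar{\tau}$ but not on $\beta_0,\beta_1,\beta_2$. *)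

(* Defs.v *)
From HB Require Import structures.
From mathcomp Require Import all_boot all_order all_algebra.
From mathcomp Require Import all_classical all_reals all_analysis.

Set Implicit Arguments.
Unset Strict Implicit.
Unset Printing Implicit Defensive.

Import Order.TTheory GRing.Theory Num.Theory.
Import numFieldNormedType.Exports.

Local Open Scope classical_set_scope.
Local Open Scope ring_scope.

Section Definitions.
Context {R : realType}.

Definition unit_itv : set (measurableTypeR R) := `[0, 1]%classic.

(* A function on [0, 1] is represented by a function on R whose values outside
   [0, 1] are irrelevant: the norm is that of the extension by 0, i.e., f is
   measurable on [0, 1] and its square has a finite integral over [0, 1]. *)
Definition L2_01 : set (R -> R) :=
  [set f | f \_ unit_itv \in Lfun lebesgue_measure 2%:E].

Definition inner01 (f g : R -> R) : R :=
  \int[lebesgue_measure]_(xi in unit_itv) (f xi * g xi).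

Definition orthonormal01 n (psi : 'I_n -> R -> R) : Prop :=
  forall i j : 'I_n, inner01 (psi i) (psi j) = (i == j)%:R.

(* Equality in L^2([0, 1]) is equality almost everywhere on [0, 1]. *)
Definition L2_span n (psi : 'I_n -> R -> R) : set (R -> R) :=
  [set f | L2_01 f /\ exists c : 'I_n -> R,
    f = (fun xi => \sum_(i < n) c i * psi i xi)
      %[ae lebesgue_measure in unit_itv]].

Definition nelson_siegel (beta0 beta1 beta2 theta tau : R) : R :=
  beta0 + beta1 * ((1 - expR (- (theta * tau))) / (theta * tau))
  + beta2 * ((1 - expR (- (theta * tau))) / (theta * tau)
             - expR (- (theta * tau))).

(* t is the rescaled maturity (tau - tau_min) / (tau_max - tau_min). *)
Definition rescaled_nelson_siegel
    (tau_min tau_max beta0 beta1 beta2 theta t : R) : R :=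
  nelson_siegel beta0 beta1 beta2 theta ((tau_max - tau_min) * t + tau_min).

End Definitions.

(* Main.v *)
Require Import Defs.
From mathcomp Require Import all_boot all_order all_algebra.
From mathcomp Require Import all_classical all_reals all_analysis.
From mathcomp Require Import measurable_realfun.
From mathcomp Require Import ring lra.

Set Implicit Arguments.
Unset Strict Implicit.
Unset Printing Implicit Defensive.

Import Order.TTheory GRing.Theory Num.Theory.
Import numFieldNormedType.Exports.

Local Open Scope classical_set_scope.
Local Open Scope ring_scope.

(* The three Nelson-Siegel factors are continuous on [0, 1], so that their Gram
   matrix G for the inner product is positive definite as soon as they are
   linearly independent, and a Cholesky factor P with P G P^T = 1 turns them
   into an orthonormal basis of their span. For the independence, put
   s = theta * tau, multiply a vanishing combination by s e^s and differentiate
   (c0 s + c1) e^s + c2 s + c3 = 0 twice to kill the affine part. *)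

(* Cholesky factorization, by elimination of the first row and column. *)
Lemma posdef_congruent1 (R : rcfType) n (G : 'M[R]_n) : G^T = G ->
  (forall c : 'rV[R]_n, c != 0 -> 0 < (c *m G *m c^T) 0 0) ->
  exists P : 'M[R]_n, P *m G *m P^T = 1%:M.
Proof.
elim: n G => [|n IHn] G symG posG; first by exists 0; apply/matrixP => -[].
change 'M[R]_(1 + n) in G.
change (exists P : 'M[R]_(1 + n), P *m G *m P^T = 1%:M).
change (forall c : 'rV[R]_(1 + n), c != 0 -> 0 < (c *m G *m c^T) 0 0) in posG.
have /eq_block_mx[_ _ symb symD] : block_mx (ulsubmx G)^T (dlsubmx G)^T
    (ursubmx G)^T (drsubmx G)^T = block_mx (ulsubmx G) (ursubmx G)
    (dlsubmx G) (drsubmx G).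
  by rewrite -tr_block_mx !submxK.
set b := ursubmx G in symb *; set D := drsubmx G in symD *.
pose a := ulsubmx G 0 0.
have GE : G = block_mx a%:M b b^T D.
  rewrite -[LHS]submxK; congr block_mx; first exact: mx11_scalar.
  by rewrite -symb.
have agt0 : 0 < a.
  (* The first unit row vector isolates the pivot [a] in the quadratic form. *)
  have := posG (row_mx 1%:M 0); rewrite GE tr_row_mx mul_row_block mul_row_col.
  rewrite !trmx0 !mulmx0 !mul0mx !addr0 trmx1 mulmx1 mul1mx mxE eqxx mulr1n.
  apply; apply/eqP => /(congr1 lsubmx); rewrite row_mxKl linear0 => /eqP.
  by rewrite oner_eq0.
(* Adding [v] times the pivot row to the rows below clears the first column; what remains there is
   the Schur complement [S], equal to [D - a^-1 b^T b]. *)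
pose v := - a^-1 *: b^T.
have vE : v *m a%:M = - b^T.
  by rewrite mul_mx_scalar scalerA mulrN divff ?gt_eqF// scaleN1r.
have vbt : a%:M *m v^T = - b.
  by rewrite -[a%:M]tr_scalar_mx -trmx_mul vE linearN /= trmxK.
pose S := v *m b + D.
pose Q : 'M[R]_(1 + n) := block_mx 1%:M 0 v 1%:M.
have QGQ : Q *m G *m Q^T = block_mx a%:M 0 0 S.
  rewrite GE /Q tr_block_mx !mulmx_block !trmx1 !trmx0.
  rewrite !mul1mx ?mulmx1 ?mul0mx ?mulmx0 ?addr0 ?add0r vE vbt.
  by rewrite !addNr mul0mx add0r.
have symS : S^T = S.
  rewrite /S linearD /= symD trmx_mul; congr (_ + _).
  by rewrite /v linearZ /= trmxK -scalemxAl -scalemxAr.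
have posS (c : 'rV[R]_n) : c != 0 -> 0 < (c *m S *m c^T) 0 0.
  move=> c0.
  (* The form of [S] at [c] is that of [G] at [(0, c) Q = (c v, c)], which is nonzero because its
     right block is [c]. *)
  have -> : c *m S *m c^T =
      (row_mx 0 c *m Q) *m G *m (row_mx 0 c *m Q)^T.
    rewrite trmx_mul -2!(mulmxA (row_mx 0 c)) (mulmxA (Q *m G)) QGQ.
    rewrite mulmxA tr_row_mx mul_row_block mul_row_col.
    by rewrite trmx0 !mulmx0 ?mul0mx ?add0r.
  apply: posG.
  rewrite /Q mul_row_block !mul0mx mulmx1 !add0r.
  by apply: contra c0 => /eqP/(congr1 rsubmx); rewrite row_mxKr linear0 => ->.
have [P PSP] := IHn S symS posS.
exists (block_mx (Num.sqrt a)^-1%:M 0 0 P *m Q).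
rewrite trmx_mul -!mulmxA (mulmxA G) (mulmxA Q) (mulmxA Q) QGQ.
rewrite tr_block_mx !mulmx_block !trmx0 tr_scalar_mx.
rewrite !mul0mx !mulmx0 ?mul0mx ?addr0 ?add0r ?mulmx0 (mulmxA P) PSP.
rewrite -!scalar_mxM mulrCA -invfM -expr2 sqr_sqrtr ?ltW// divff ?gt_eqF//.
exact: esym (scalar_mx_block _ _ _).
Qed.

(** * Continuous functions on [0, 1]: square integrability and orthonormalization *)

Section ContinuousFunctions.
Context {R : realType}.
Implicit Types f g : R -> R.

Local Notation continuous01 f := {in `[0, 1]%R, continuous f}.

Let measurable_unit_itv : measurable (@unit_itv R).
Proof. exact: measurable_itv. Qed.
#[local] Hint Resolve measurable_unit_itv : core.

Lemma continuous01_lincomb n (c : 'I_n -> R) (f : 'I_n -> R -> R) :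
  (forall i, continuous01 (f i)) ->
  continuous01 (fun x => \sum_(i < n) c i * f i x).
Proof.
move=> cf x x01; apply: cvg_big => [|i _]; first exact: add_continuous.
by apply: cvgM; [exact: cvg_cst | exact: cf].
Qed.

Lemma continuous01M f g : continuous01 f -> continuous01 g ->
  continuous01 (fun x => f x * g x).
Proof. by move=> cf cg x x01; apply: cvgM; [exact: cf | exact: cg]. Qed.

Lemma integrable01 f : continuous01 f ->
  lebesgue_measure.-integrable unit_itv (EFin \o f).
Proof.
move=> cf; apply: continuous_compact_integrable; first exact: segment_compact.
by apply: continuous_in_subspaceT => x /[!inE]; exact: cf.
Qed.

Lemma continuous01_L2 f : continuous01 f -> L2_01 f.
Proof.
move=> cf; have cff := continuous01M cf cf.
have mf : measurable_fun unit_itv f.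
  by apply/measurable_EFinP; have /integrableP[] := integrable01 cf.
apply/andP; split; rewrite inE /=.
  by apply/(measurable_restrictT _ measurable_unit_itv).
rewrite /finite_norm unlock; apply: poweR_lty.
(* The squared norm is a real power of the extension by 0; as an extension of [f * f] it integrates
   over [0, 1] only. *)
rewrite (_ : (fun x => _) = (EFin \o (fun x => f x * f x)) \_ unit_itv).
  rewrite -integral_mkcond; have /integrableP[mff] := integrable01 cff.
  apply: le_lt_trans; apply: ge0_le_integral => //.
  - by move=> x _ /=; rewrite lee_fin -expr2 sqr_ge0.
  - exact: measurableT_comp.
  - by move=> x _ /=; rewrite lee_fin ler_norm.
apply/funext => x; rewrite /= !patchE; case: ifPn => _.
  by rewrite powR_mulrn// real_normK ?num_real// expr2.
by rewrite normr0 powR0// pnatr_eq0.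
Qed.

Lemma inner01C f g : inner01 f g = inner01 g f.
Proof. by apply: eq_Rintegral => x _; rewrite mulrC. Qed.

Lemma inner01_lincombl n (c : 'I_n -> R) (f : 'I_n -> R -> R) g :
  (forall i, continuous01 (f i)) -> continuous01 g ->
  inner01 (fun x => \sum_(i < n) c i * f i x) g =
  \sum_(i < n) c i * inner01 (f i) g.
Proof.
elim: n c f => [|n IHn] c f cf cg.
  rewrite big_ord0 /inner01.
  under eq_Rintegral do rewrite big_ord0 mul0r.
  by rewrite Rintegral_cst ?mul0r//.
rewrite big_ord_recl -IHn// /inner01.
under eq_Rintegral do rewrite big_ord_recl mulrDl -mulrA.
rewrite RintegralD//; last 2 first.
- apply: integrable01 => x x01; apply: cvgM; first exact: cvg_cst.
  exact: continuous01M.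
- by apply/integrable01/continuous01M => //; exact: continuous01_lincomb.
by rewrite RintegralZl//; apply: integrable01; exact: continuous01M.
Qed.

(** By continuity [f * f] exceeds half its value at [x] on a small closed ball, which fits in [0, 1]
    since [x] is interior and has positive measure. *)
Lemma inner01_gt0 f x : continuous01 f -> x \in `]0, 1[%R -> f x != 0 ->
  0 < inner01 f f.
Proof.
move=> cf x01 fx0.
have x01c : x \in `[0, 1]%R by exact: subset_itv_oo_cc.
have cff := continuous01M cf cf.
have /integrableP[mff intff] := integrable01 cff.
pose c := (f x * f x) / 2.
have c0 : 0 < c by rewrite divr_gt0// -expr2 exprn_even_gt0.
have : \forall y \near x, y \in `]0, 1[%R /\ c < f y * f y.
  apply: filterI; first exact: near_in_itvoo.
  apply: (cvgr_gt _ (cff _ x01c)).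
  by rewrite ltr_pdivrMr// mulr_natr mulr2n ltrDl -expr2 exprn_even_gt0.
move=> /nbhs_closedballP[e ballS].
have mball : measurable (closed_ball x e%:num : set (measurableTypeR R)).
  exact: measurable_closed_ball.
have ball01 : closed_ball x e%:num `<=` unit_itv.
  by move=> y /ballS[/subset_itv_oo_cc].
(* The real integral is the [fine] part of an extended one, and [fine] sends infinity to 0:
   finiteness is needed besides positivity. *)
apply: fine_gt0; apply/andP; split; last first.
  apply: le_lt_trans intff; apply: ge0_le_integral => //.
  - by move=> y _ /=; rewrite lee_fin -expr2 sqr_ge0.
  - exact: measurableT_comp.
  - by move=> y _ /=; rewrite lee_fin ler_norm.
apply: (@lt_le_trans _ _ (c%:E * lebesgue_measure (closed_ball x e%:num)))%E.
  rewrite mule_gt0 ?lte_fin// lebesgue_measure_closed_ball//.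
rewrite -integral_cst//.
apply: (@le_trans _ _
  (\int[lebesgue_measure]_(y in closed_ball x e%:num) (f y * f y)%:E)%E).
  apply: ge0_le_integral => //=.
  - by move=> y _; rewrite lee_fin ltW.
  - exact: measurable_funS mff.
  - by move=> y /ballS[_ cy]; rewrite lee_fin ltW.
apply: ge0_subset_integral => //.
by move=> y _; rewrite lee_fin -expr2 sqr_ge0.
Qed.

(** If [P G P^T = 1] for the Gram matrix [G], the rows of [P] are the coefficients of an orthonormal
    family. Freeness is tested on the open interval because [inner01_gt0] needs an interior
    point. *)
Lemma orthonormal_basis n (f : 'I_n -> R -> R) :
  (forall i, continuous01 (f i)) ->
  (forall c : 'rV[R]_n,
    {in `]0, 1[%R, forall x, \sum_(i < n) c 0 i * f i x = 0} -> c = 0) ->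
  exists psi : 'I_n -> R -> R,
    [/\ forall i, continuous01 (psi i), orthonormal01 psi
      & exists B : 'M[R]_n, forall i x, f i x = \sum_(j < n) B i j * psi j x].
Proof.
move=> cf free_f.
pose G : 'M[R]_n := \matrix_(i, j) inner01 (f i) (f j).
pose comb (c : 'rV[R]_n) x := \sum_(i < n) c 0 i * f i x.
have ccomb c : continuous01 (comb c) by exact: continuous01_lincomb.
have GE (c d : 'rV[R]_n) : inner01 (comb c) (comb d) = (c *m G *m d^T) 0 0.
  rewrite inner01_lincombl// -mulmxA mxE; apply: eq_bigr => i _.
  rewrite inner01C inner01_lincombl// mxE; congr (_ * _).
  by apply: eq_bigr => j _; rewrite !mxE mulrC inner01C.
have symG : G^T = G by apply/matrixP => i j; rewrite !mxE inner01C.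
have posG (c : 'rV[R]_n) : c != 0 -> 0 < (c *m G *m c^T) 0 0.
  move=> c0; rewrite -GE.
  have [x [x01 cx0]] : exists x, x \in `]0, 1[%R /\ comb c x != 0.
    apply: contrapT => nex; move/eqP: c0; apply; apply: free_f => x x01.
    by apply: contrapT => /eqP cx0; apply: nex; exists x.
  exact: inner01_gt0 (ccomb c) x01 cx0.
have [P PGP] := posdef_congruent1 symG posG.
exists (fun i => comb (row i P)); split => [i||]; first exact: ccomb.
  move=> i j; rewrite GE -row_mul; move/matrixP/(_ i j): PGP.
  by rewrite !mxE => <-; apply: eq_bigr => k _; rewrite !mxE.
have Punit : P \in unitmx.
  by have [_] := mulmx1_unit PGP; rewrite unitmx_tr.
(* At each [x] the values of the new family form the column [P F], so [P^-1] recovers [F]. *)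
exists (invmx P) => i x; pose F := \col_k f k x.
have /matrixP/(_ i 0) := mulKmx Punit F; rewrite !mxE => <-.
apply: eq_bigr => j _; rewrite !mxE; congr (_ * _).
by apply: eq_bigr => k _; rewrite !mxE.
Qed.

End ContinuousFunctions.

(** * Continuity and linear independence of the Nelson-Siegel factors *)

Lemma rescaled_maturity_gt0 (R : realType) (tau_min tau_max t : R) :
  0 < tau_min -> tau_min < tau_max -> t \in `[0, 1]%R ->
  0 < (tau_max - tau_min) * t + tau_min.
Proof.
move=> tau_min_gt0 tau_min_lt; rewrite in_itv/= => /andP[t0 _].
by rewrite ltr_wpDl// mulr_ge0// subr_ge0 ltW.
Qed.

Lemma continuous_rescaled_nelson_siegel (R : realType)
    (tau_min tau_max theta b0 b1 b2 : R) :
  0 < tau_min -> tau_min < tau_max -> theta != 0 ->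
  {in `[0, 1]%R,
   continuous (rescaled_nelson_siegel tau_min tau_max b0 b1 b2 theta)}.
Proof.
move=> tau_min_gt0 tau_min_lt theta0 t.
move=> /(rescaled_maturity_gt0 tau_min_gt0 tau_min_lt) tau_gt0.
rewrite /rescaled_nelson_siegel /nelson_siegel.
have cs : {for t, continuous
    (fun t => theta * ((tau_max - tau_min) * t + tau_min))}.
  apply: cvgM; first exact: cvg_cst.
  apply: cvgD; last exact: cvg_cst.
  by apply: cvgM; [exact: cvg_cst|exact: cvg_id].
have cE : {for t, continuous
    (fun t => expR (- (theta * ((tau_max - tau_min) * t + tau_min))))}.
  by apply: continuous_comp; [exact: cvgN|exact: continuous_expR].
have cslope : {for t, continuous (fun t =>
    (1 - expR (- (theta * ((tau_max - tau_min) * t + tau_min)))) /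
    (theta * ((tau_max - tau_min) * t + tau_min)))}.
  apply: cvgM; first by apply: cvgB => //; exact: cvg_cst.
  by apply: cvgV => //; rewrite mulf_neq0// gt_eqF.
apply: cvgD; first apply: cvgD; first exact: cvg_cst.
  by apply: cvgM => //; exact: cvg_cst.
by apply: cvgM; [exact: cvg_cst|exact: cvgB].
Qed.

(** A derivative is local, and [g] agrees with the zero function near each point of the open
    interval. *)
Lemma derive_eq0_in_itv (R : realType) (g dg : R -> R) (a b : R) :
  {in `]a, b[%R, forall t, g t = 0} ->
  (forall t, is_derive t (1 : R) g (dg t)) ->
  {in `]a, b[%R, forall t, dg t = 0}.
Proof.
move=> g0 Dg t tab; have [_ <-] := Dg t.
rewrite (@near_eq_derive _ _ _ g (cst 0)) ?derive_cst//.
by near=> u; apply: g0; near: u; exact: near_in_itvoo.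
Unshelve. all: by end_near. Qed.

Lemma exp_affine_free (R : realType) (k l c0 c1 c2 c3 : R) : k != 0 ->
  {in `]0, 1[%R, forall t,
    (c0 * (k * t + l) + c1) * expR (k * t + l) + c2 * (k * t + l) + c3 = 0} ->
  [/\ c0 = 0, c1 = 0 & c2 = 0].
Proof.
move=> k0 g0; pose s t := k * t + l.
have Ds t : is_derive t (1 : R) s k.
  by rewrite /s; apply: is_derive_eq; rewrite addr0 /GRing.scale/= mulr1.
have DE t : is_derive t (1 : R) (fun t => expR (s t)) (k * expR (s t)).
  by apply: is_derive_eq; rewrite mulrC.
have Dg t : is_derive t (1 : R)
    (fun t => (c0 * s t + c1) * expR (s t) + c2 * s t + c3)
    (k * ((c0 * s t + c0 + c1) * expR (s t) + c2)).
  by apply: is_derive_eq; rewrite /GRing.scale/=; ring.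
have Ddg t : is_derive t (1 : R)
    (fun t => k * ((c0 * s t + c0 + c1) * expR (s t) + c2))
    (k ^+ 2 * ((c0 * s t + c0 *+ 2 + c1) * expR (s t))).
  by apply: is_derive_eq; rewrite /GRing.scale/=; ring.
have Dq t : is_derive t (1 : R) (fun t => c0 * s t + c0 *+ 2 + c1) (c0 * k).
  by apply: is_derive_eq; rewrite /GRing.scale/=; ring.
have dg0 := derive_eq0_in_itv g0 Dg.
have ddg0 := derive_eq0_in_itv dg0 Ddg.
(* In the second derivative neither [k ^+ 2] nor the exponential vanishes, which leaves the affine
   factor; its own derivative [c0 * k] then gives [c0 = 0]. *)
have q0 : {in `]0, 1[%R, forall t, c0 * s t + c0 *+ 2 + c1 = 0}.
  move=> t /ddg0/eqP; rewrite !mulf_eq0 (negPf k0)/=.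
  by rewrite (gt_eqF (expR_gt0 _)) orbF => /eqP.
have h01 : (2^-1 : R) \in `]0, 1[%R by rewrite in_itv/=; lra.
have c00 : c0 = 0.
  have /eqP := derive_eq0_in_itv q0 Dq h01.
  by rewrite mulf_eq0 (negPf k0) orbF => /eqP.
have c10 : c1 = 0 by have := q0 _ h01; rewrite c00 mul0r mul0rn !add0r.
(* With [c0] and [c1] zero, the first derivative reduces to [k * c2]. *)
split=> //; have /eqP := dg0 _ h01.
by rewrite c00 c10 !mul0r !addr0 mul0r add0r mulf_eq0 (negPf k0) => /eqP.
Qed.

Lemma rescaled_nelson_siegel_eq0 (R : realType) (tau_min tau_max theta : R)
    (b0 b1 b2 : R) :
  0 < tau_min -> tau_min < tau_max -> theta != 0 ->
  {in `]0, 1[%R, forall t,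
    rescaled_nelson_siegel tau_min tau_max b0 b1 b2 theta t = 0} ->
  [/\ b0 = 0, b1 = 0 & b2 = 0].
Proof.
move=> tau_min_gt0 tau_min_lt theta0 y0.
pose k := theta * (tau_max - tau_min); pose l := theta * tau_min.
have k0 : k != 0 by rewrite mulf_neq0// subr_eq0 gt_eqF.
(* Here [k * t + l] is [theta * tau], and the coefficients come from multiplying the term structure
   by [s * expR s]. *)
have /(exp_affine_free k0)[b00 b12 /eqP] : {in `]0, 1[%R, forall t,
    (b0 * (k * t + l) + (b1 + b2)) * expR (k * t + l) + (- b2) * (k * t + l)
    + - (b1 + b2) = 0}.
  move=> t t01; have tau_gt0 : 0 < (tau_max - tau_min) * t + tau_min.
    exact: rescaled_maturity_gt0 _ _ (subset_itv_oo_cc t01).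
  have := y0 t t01; rewrite /rescaled_nelson_siegel /nelson_siegel.
  have -> : theta * ((tau_max - tau_min) * t + tau_min) = k * t + l.
    by rewrite /k /l; ring.
  have : k * t + l != 0.
    by rewrite /k /l -mulrA -mulrDr mulf_neq0// gt_eqF.
  move: (k * t + l) => s s0.
  rewrite expRN => /(congr1 (fun y => y * (s * expR s))); rewrite mul0r => <-.
  have E0 : expR s != 0 by rewrite gt_eqF// expR_gt0.
  by field; rewrite s0 E0.
rewrite oppr_eq0 => /eqP b20; split=> //.
by move: b12; rewrite b20 addr0.
Qed.

Theorem theorem1 (R : realType) (tau_min tau_max theta : R)
    (tau_min_gt0 : 0 < tau_min) (tau_min_lt : tau_min < tau_max)
    (theta_neq0 : theta != 0) :
  exists psi : 'I_3 -> R -> R,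
    [/\ forall i, L2_01 (psi i),
        orthonormal01 psi
      & forall beta0 beta1 beta2 : R,
          L2_span psi
            (rescaled_nelson_siegel tau_min tau_max beta0 beta1 beta2 theta)].
Proof.
pose y b0 b1 b2 := rescaled_nelson_siegel tau_min tau_max b0 b1 b2 theta.
(* The three factors are the term structures whose coefficients are the unit vectors. *)
pose f (i : 'I_3) := y (i == 0)%:R (i == 1)%:R (i == 2)%:R.
have yE (c : 'I_3 -> R) x : \sum_(i < 3) c i * f i x = y (c 0) (c 1) (c 2) x.
  rewrite 3!big_ord_recl big_ord0 /f /y /rescaled_nelson_siegel /nelson_siegel.
  rewrite /= (_ : lift ord0 ord0 = 1); last exact/val_inj.
  rewrite (_ : lift ord0 (lift ord0 ord0) = 2); last exact/val_inj.
  by rewrite /=; ring.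
have cy b0 b1 b2 : {in `[0, 1]%R, continuous (y b0 b1 b2)}.
  exact: continuous_rescaled_nelson_siegel.
have free_f (c : 'rV[R]_3) :
    {in `]0, 1[%R, forall x, \sum_(i < 3) c 0 i * f i x = 0} -> c = 0.
  move=> fc0; have /rescaled_nelson_siegel_eq0[]// : {in `]0, 1[%R, forall x,
      y (c 0 0) (c 0 1) (c 0 2) x = 0}.
    by move=> x x01; rewrite -yE fc0.
  move=> c00 c01 c02; apply/rowP => i; rewrite mxE.
  by case: i => -[|[|[|//]]] i3; [rewrite -[RHS]c00|rewrite -[RHS]c01|
    rewrite -[RHS]c02]; congr (c _ _); exact/val_inj.
have [//|psi [cpsi opsi [B fB]]] := orthonormal_basis _ free_f.
  by move=> i; exact: cy.
exists psi; split=> // [i|b0 b1 b2]; first exact: continuous01_L2.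
split; first exact/continuous01_L2/cy.
pose b (i : 'I_3) := [:: b0; b1; b2]`_i.
(* Substituting the expansion of each factor in [psi] gives the row [b B] as coefficients; the
   equality holds at every point, hence almost everywhere. *)
exists (fun j => \sum_(i < 3) b i * B i j); apply: aeW => x _.
rewrite -/(y b0 b1 b2) -[LHS](yE b).
under eq_bigr do rewrite fB mulr_sumr.
under [RHS]eq_bigr do rewrite mulr_suml.
rewrite exchange_big; apply: eq_bigr => j _; apply: eq_bigr => i _.
by rewrite mulrA.
Qed.
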